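(* Let $V$ and $W$ be nontrivial real Hilbert spaces and let $G\leq O(V)$ be any subgroup of the orthogonal group of $V$. (a) If $G$ acts topologically transitively on $S(V)$, then for every $f\colon S(V)/\!/G\to S(W)$, the homogeneous extension $f^\star\colon V/\!/G\to W$ is an isometry (i.e., distance-preserving). (b) If $G$ does not act topologically transitively on $S(V)$, then for every $f\colon S(V)/\!/G\to S(W)$ with optimal bilipschitz bounds $\alpha$ and $\beta$, the homogeneous extension $f^\star\colon V/\!/G\to W$ has optimal bilipschitz bounds $\min\{\alpha,1\}$ and $\max\{\beta,1\}$.
   Context: $O(V)$ is the group of linear isometric bijections of $V$, and $S(V)$ is the unit sphere of $V$. For a group $G$ acting by isometries on a metric space $X$, put $d_{X/G}(G\cdot x,G\cdot y)=\inf\{d_X(p,q):p\in G\cdot x,\ q\in G\cdot y\}$, a pseudometric on the set of orbits. The metric quotient is $X/\!/G=\{[x]:x\in X\}$ with $[x]=\{y\in X:d_{X/G}(G\cdot x,G\cdot y)=0\}$ (which equals the closure of $G\cdot x$), with metric $d([x],[y])=d_{X/G}(G\cdot x,G\cdot y)$. $G$ acts topologically transitively on a topological space $X$ if some orbit $G\cdot x$ is dense in $X$. For a map $f\colon X\to Y$ of metric spaces, where $X$ has at least two points, the optimal (lower and upper) bilipschitz bounds $\alpha,\beta\in[0,\infty]$ are the largest and smallest constants, respectively, such that $\alpha\, d_X(x,x')\leq d_Y(f(x),f(x'))\leq\beta\, d_X(x,x')$ for all $x,x'\in X$ (so $\beta=\infty$ is allowed when $f$ is not Lipschitz, and $\alpha=0$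 when $f$ is not lower Lipschitz). The homogeneous extension of $f\colon S(V)/\!/G\to S(W)$ is the (well-defined) map $f^\star\colon V/\!/G\to W$ given by $f^\star([cu])=c\,f([u])$ for $u\in S(V)$ and $c\geq0$. *)

(* Defs.v *)
From HB Require Import structures.
From mathcomp Require Import all_boot all_order all_algebra.
From mathcomp Require Import all_classical all_reals all_analysis.

Set Implicit Arguments.
Unset Strict Implicit.
Unset Printing Implicit Defensive.

Import Order.TTheory GRing.Theory Num.Theory.
Import numFieldNormedType.Exports.

Local Open Scope classical_set_scope.
Local Open Scope ring_scope.

(* The metric structure of a normed space is not part of [normedModType]; it is
   added here so that [mdist] is available, and tied to the norm. *)
HB.mixin Record isHilbert (R : realType) V
    & CompleteNormedModule R V & Metric R V := {
  inner : {dot V for idfun} ;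
  normr_inner : forall x : V, `|x| ^+ 2 = inner x x ;
  mdist_normB : forall x y : V, mdist x y = `|x - y|
}.

#[short(type="hilbertType")]
HB.structure Definition Hilbert (R : realType) :=
  {V of CompleteNormedModule R V & Metric R V & isHilbert R V}.

(* The induced (for the unit sphere: chordal) metric, on top of the subset
   topology that [set_type] already carries. *)
Section SubsetMetric.
Context {R : realType} {X : metricType R} (A : set X).

Let subset_mdist (x y : A) : R := mdist (set_val x) (set_val y).

Let subset_mdist_ge0 x y : 0 <= subset_mdist x y.
Proof. exact: mdist_ge0. Qed.

Let subset_mdist_positivity x y : subset_mdist x y = 0 -> x = y.
Proof. by move=> /mdist_positivity /val_inj. Qed.

Let ballE_subset_mdist x d : ball x d = [set y | subset_mdist x y < d].
Proof.
have -> : ball x d = set_val @^-1` (ball (set_val x) d) by [].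
by rewrite ballEmdist.
Qed.

HB.instance Definition _ := PseudoMetric_isMetric.Build R (set_type A)
  subset_mdist_ge0 subset_mdist_positivity ballE_subset_mdist.

End SubsetMetric.

Definition distance_preserving (R : realType) (X Y : metricType R)
    (f : X -> Y) : Prop :=
  forall x x', mdist (f x) (f x') = mdist x x'.

(* [mule] follows the convention 0 * +oo = 0 *)
Definition lower_lipschitz_bound (R : realType) (X Y : metricType R)
    (f : X -> Y) (a : \bar R) : Prop :=
  forall x x', (a * (mdist x x')%:E <= (mdist (f x) (f x'))%:E)%E.

Definition upper_lipschitz_bound (R : realType) (X Y : metricType R)
    (f : X -> Y) (b : \bar R) : Prop :=
  forall x x', ((mdist (f x) (f x'))%:E <= b * (mdist x x')%:E)%E.

Definition optimal_bilipschitz_bounds (R : realType) (X Y : metricType R)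
    (f : X -> Y) (a b : \bar R) : Prop :=
  [/\ (0 <= a)%E, lower_lipschitz_bound f a &
      forall a', (0 <= a')%E -> lower_lipschitz_bound f a' -> (a' <= a)%E] /\
  [/\ (0 <= b)%E, upper_lipschitz_bound f b &
      forall b', (0 <= b')%E -> upper_lipschitz_bound f b' -> (b <= b')%E].

Record isometric_action (R : realType) (gT : groupType) (X : metricType R) :=
  IsometricAction {
    iact :> gT -> X -> X ;
    iact1 : forall x, iact 1%g x = x ;
    iactM : forall g h x, iact (g * h)%g x = iact g (iact h x) ;
    iact_isometry : forall g, distance_preserving (iact g)
  }.

Section MetricQuotient.
Context {R : realType} {gT : groupType} {X : metricType R}.
Variables (to : isometric_action gT X) (G : groupClosed gT).

Definition iorbit (x : X) : set X := [set to g x | g in [set` G]].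

Definition topologically_transitive : Prop := exists x : X, dense (iorbit x).

Definition orbit_dist (x y : X) : R :=
  inf [set mdist p q | p in iorbit x & q in iorbit y].

Definition metric_class (x : X) : set X := [set y | orbit_dist x y = 0].

Definition metric_quotient : Type := set_type (range metric_class).

HB.instance Definition _ := gen_eqMixin metric_quotient.
HB.instance Definition _ := gen_choiceMixin metric_quotient.

Definition mquot_pi (x : X) : metric_quotient :=
  @SigSub _ _ _ (metric_class x) (mem_set (imageT metric_class x)).

Lemma mquot_pi_surj (A : metric_quotient) : exists x, mquot_pi x = A.
Proof.
by case: A => A AP; have /set_mem[x _ xA] := AP; exists x; apply: val_inj.
Qed.

Definition mquot_repr (A : metric_quotient) : X := projT1 (cid (mquot_pi_surj A)).

Lemma mquot_reprK : cancel mquot_repr mquot_pi.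
Proof. by move=> A; rewrite /mquot_repr; case: cid. Qed.

Lemma iactK g : cancel (to g) (to g^-1%g).
Proof. by move=> x; rewrite -iactM mulVg iact1. Qed.

Let dset x y := [set mdist p q | p in iorbit x & q in iorbit y].

Let dset_lb x y : lbound (dset x y) 0.
Proof. by move=> _ [p _ [q _ <-]]; exact: mdist_ge0. Qed.

Lemma iorbit_refl x : iorbit x x.
Proof. by exists 1%g; [exact: gpred1|exact: iact1]. Qed.

Let dset_has_inf x y : has_inf (dset x y).
Proof.
split; last by exists 0; exact: dset_lb.
by exists (mdist x y), x; [exact: iorbit_refl|exists y => //; exact: iorbit_refl].
Qed.

Lemma orbit_dist_ge0 x y : 0 <= orbit_dist x y.
Proof. by apply: lb_le_inf; [case: (dset_has_inf x y)|exact: dset_lb]. Qed.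

Lemma orbit_dist_le x y g : g \in G -> orbit_dist x y <= mdist x (to g y).
Proof.
move=> gG; apply: ge_inf; first by exists 0; exact: dset_lb.
by exists x; [exact: iorbit_refl|exists (to g y) => //; exists g].
Qed.

Lemma orbit_dist_lt x y (e : R) : 0 < e ->
  exists2 g, g \in G & mdist x (to g y) < orbit_dist x y + e.
Proof.
move=> e0; have [_ [p [g gG <-] [q [h hG <-] <-]] lte] :=
  inf_adherent e0 (dset_has_inf x y).
exists (g^-1 * h)%g; first by rewrite gpredM ?gpredV.
by rewrite iactM -(iact_isometry to g) -(iactM _ g g^-1%g) mulgV iact1.
Qed.

Lemma orbit_distxx x : orbit_dist x x = 0.
Proof.
apply/eqP; rewrite eq_le orbit_dist_ge0 andbT.
by rewrite (le_trans (orbit_dist_le x x (gpred1 : 1%g \in G)))// iact1 mdistxx.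
Qed.

Lemma orbit_distC x y : orbit_dist x y = orbit_dist y x.
Proof.
rewrite /orbit_dist; congr inf; apply/seteqP.
by split => _ [p pP [q qP <-]]; exists q => //; exists p => //; rewrite metric_sym.
Qed.

Lemma orbit_dist_triangle y x z :
  orbit_dist x z <= orbit_dist x y + orbit_dist y z.
Proof.
apply/ler_addgt0Pl => e e0; rewrite addrC.
have e20 : 0 < e / 2 by rewrite divr_gt0.
have [g gG xy] := orbit_dist_lt x y e20.
have [h hG yz] := orbit_dist_lt y z e20.
apply: (le_trans (orbit_dist_le _ _ (gpredM _ _ gG hG))).
rewrite [e in leRHS]splitr addrACA iactM.
apply: le_trans (lerD (ltW xy) (ltW yz)).
by rewrite -(iact_isometry to g y) metric_triangle.
Qed.

Lemma mquot_piP x y : mquot_pi x = mquot_pi y <-> orbit_dist x y = 0.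
Proof.
split=> [/(congr1 val)/= /(congr1 (fun A => A y))/=|xy].
  by rewrite /metric_class /= orbit_distxx => ->.
apply: val_inj => /=; apply/seteqP; split=> z; rewrite /metric_class /= => xz;
  apply/eqP; rewrite eq_le orbit_dist_ge0 andbT.
  by rewrite (le_trans (orbit_dist_triangle x _ _))// orbit_distC xy xz addr0.
by rewrite (le_trans (orbit_dist_triangle y _ _))// xy xz addr0.
Qed.

(* Independent of the choice of representatives by [mquot_dist_pi]. *)
Definition mquot_dist (A B : metric_quotient) : R :=
  orbit_dist (mquot_repr A) (mquot_repr B).

Lemma mquot_dist_pi x y : mquot_dist (mquot_pi x) (mquot_pi y) = orbit_dist x y.
Proof.
have rx u : orbit_dist (mquot_repr (mquot_pi u)) u = 0.
  by apply/mquot_piP; rewrite mquot_reprK.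
rewrite /mquot_dist; apply/eqP; rewrite eq_le; apply/andP; split.
  rewrite (le_trans (orbit_dist_triangle x _ _))// rx add0r.
  by rewrite (le_trans (orbit_dist_triangle y _ _))// (orbit_distC y) rx addr0.
rewrite (le_trans (orbit_dist_triangle (mquot_repr (mquot_pi x)) _ _))//.
rewrite (orbit_distC x) rx add0r.
rewrite (le_trans (orbit_dist_triangle (mquot_repr (mquot_pi y)) _ _))//.
by rewrite rx addr0.
Qed.

Let mquot_distxx A : mquot_dist A A = 0.
Proof. exact: orbit_distxx. Qed.

Let mquot_dist_positivity A B : mquot_dist A B = 0 -> A = B.
Proof. by move=> /mquot_piP; rewrite !mquot_reprK. Qed.

Let mquot_dist_sym A B : mquot_dist A B = mquot_dist B A.
Proof. exact: orbit_distC. Qed.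

Let mquot_dist_triangle B A C :
  mquot_dist A C <= mquot_dist A B + mquot_dist B C.
Proof. exact: orbit_dist_triangle. Qed.

HB.instance Definition _ := isMetric.Build R metric_quotient
  mquot_distxx mquot_dist_positivity mquot_dist_sym mquot_dist_triangle.

End MetricQuotient.

Section Orthogonal.
Context {R : realType} (V : hilbertType R).

Definition orthogonal_set : set (V -> V) :=
  [set f | [/\ linear f, distance_preserving f & bijective f]].

Definition orthogonal_group : Type := set_type orthogonal_set.

HB.instance Definition _ := gen_eqMixin orthogonal_group.
HB.instance Definition _ := gen_choiceMixin orthogonal_group.

Definition orthogonal_fun (g : orthogonal_group) : V -> V := val g.

Definition mk_orthogonal f (fO : orthogonal_set f) : orthogonal_group :=
  @SigSub _ _ _ f (mem_set fO).

Let orthogonalP (g : orthogonal_group) : orthogonal_set (orthogonal_fun g).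
Proof. exact/set_mem/(valP g). Qed.

Let orth1_subproof : orthogonal_set id.
Proof. by split=> //; exists id. Qed.

Let orthM_subproof (g h : orthogonal_group) :
  orthogonal_set (orthogonal_fun g \o orthogonal_fun h).
Proof.
have [gl gi gb] := orthogonalP g; have [hl hi hb] := orthogonalP h.
split; last exact: bij_comp.
- by move=> a x y /=; rewrite hl gl.
- by move=> x y /=; rewrite gi hi.
Qed.

Let orth_inv_ex (g : orthogonal_group) : exists2 h : V -> V,
  cancel (orthogonal_fun g) h & cancel h (orthogonal_fun g).
Proof. by have [_ _ [h gK hK]] := orthogonalP g; exists h. Qed.

Definition orth_inv_fun (g : orthogonal_group) : V -> V :=
  s2val (cid2 (orth_inv_ex g)).

Let orth_inv_funK g : cancel (orthogonal_fun g) (orth_inv_fun g).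
Proof. by rewrite /orth_inv_fun; case: cid2. Qed.

Let orth_inv_funVK g : cancel (orth_inv_fun g) (orthogonal_fun g).
Proof. by rewrite /orth_inv_fun; case: cid2. Qed.

Let orthV_subproof (g : orthogonal_group) : orthogonal_set (orth_inv_fun g).
Proof.
have [gl gi _] := orthogonalP g; split.
- by move=> a x y; rewrite -[RHS](orth_inv_funK g) gl !orth_inv_funVK.
- by move=> x y; rewrite -gi !orth_inv_funVK.
- by exists (orthogonal_fun g); [exact: orth_inv_funVK|exact: orth_inv_funK].
Qed.

Definition orth_one : orthogonal_group := mk_orthogonal orth1_subproof.

Definition orth_mul (g h : orthogonal_group) : orthogonal_group :=
  mk_orthogonal (orthM_subproof g h).

Definition orth_inv (g : orthogonal_group) : orthogonal_group :=
  mk_orthogonal (orthV_subproof g).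

Let orth_mulA : associative orth_mul.
Proof. by move=> f g h; apply: val_inj. Qed.

Let orth_mul1g : left_id orth_one orth_mul.
Proof. by move=> f; apply: val_inj. Qed.

Let orth_mulg1 : right_id orth_one orth_mul.
Proof. by move=> f; apply: val_inj. Qed.

Let orth_mulVg : left_inverse orth_one orth_inv orth_mul.
Proof. by move=> g; apply/val_inj/funext => x; exact: orth_inv_funK. Qed.

Let orth_mulgV : right_inverse orth_one orth_inv orth_mul.
Proof. by move=> g; apply/val_inj/funext => x; exact: orth_inv_funVK. Qed.

HB.instance Definition _ := isGroup.Build orthogonal_group
  orth_mulA orth_mul1g orth_mulg1 orth_mulVg orth_mulgV.

Definition orthogonal_action : isometric_action orthogonal_group V.
Proof.
exists orthogonal_fun => //.
by move=> g; case: (orthogonalP g).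
Defined.

Definition sphere : set V := [set u | `|u| = 1].

Lemma orthogonal_fun0 (g : orthogonal_group) : orthogonal_fun g 0 = 0.
Proof.
have [gl _ _] := orthogonalP g.
by have := gl (-1) 0 0; rewrite scaler0 addr0 scaleN1r addNr.
Qed.

Lemma orthogonal_funZ (g : orthogonal_group) a x :
  orthogonal_fun g (a *: x) = a *: orthogonal_fun g x.
Proof.
have [gl _ _] := orthogonalP g.
by have := gl a x 0; rewrite orthogonal_fun0 !addr0.
Qed.

Lemma orthogonal_norm (g : orthogonal_group) x : `|orthogonal_fun g x| = `|x|.
Proof.
have [_ gi _] := orthogonalP g.
by have := gi x 0; rewrite !mdist_normB orthogonal_fun0 !subr0.
Qed.

Let sphere_stable (g : orthogonal_group) (u : sphere) :
  sphere (orthogonal_fun g (set_val u)).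
Proof. by rewrite /sphere /= orthogonal_norm; exact: (set_valP u). Qed.

Definition sphere_act (g : orthogonal_group) (u : sphere) : sphere :=
  @SigSub _ _ _ (orthogonal_fun g (set_val u)) (mem_set (sphere_stable g u)).

Definition sphere_action : isometric_action orthogonal_group sphere.
Proof.
exists sphere_act.
- by move=> u; apply: val_inj.
- by move=> g h u; apply: val_inj.
- by move=> g u v; case: (orthogonalP g) => _ gi _; exact: gi.
Defined.

End Orthogonal.

Arguments sphere {R} V.
Arguments orthogonal_set {R} V.

Section HomogeneousExtension.
Context {R : realType} {V W : hilbertType R} (G : groupClosed (orthogonal_group V)).
Local Notation SV_G := (metric_quotient (sphere_action V) G).
Local Notation V_G := (metric_quotient (orthogonal_action V) G).
Variable f : SV_G -> sphere W.

(* [insub] fails only at the zero vector; [hom_extE] is the defining property,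
   and characterizes [hom_ext] since every vector is some c *: u. *)
Definition hom_ext (A : V_G) : W :=
  let x := mquot_repr A in
  if insub (`|x|^-1 *: x) is Some u then
    `|x| *: set_val (f (mquot_pi (sphere_action V) G u))
  else 0.

Lemma hom_extE (c : R) (u : sphere V) : 0 <= c ->
  hom_ext (mquot_pi (orthogonal_action V) G (c *: set_val u)) =
  c *: set_val (f (mquot_pi (sphere_action V) G u)).
Proof.
move=> c0; rewrite /hom_ext; set A := mquot_pi _ _ _; set x := mquot_repr A.
have xcu : orbit_dist (orthogonal_action V) G x (c *: set_val u) = 0.
  by apply/mquot_piP; rewrite mquot_reprK.
have u1 : `|set_val u| = 1 by exact: (set_valP u).
have cu1 : `|c *: set_val u| = c by rewrite normrZ u1 mulr1 ger0_norm.
have near_orbit e : 0 < e -> exists2 g, g \in G &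
    `|x - orthogonal_fun g (c *: set_val u)| < e.
  move=> /(@orbit_dist_lt _ _ _ (orthogonal_action V) G x (c *: set_val u))[g gG].
  by rewrite xcu add0r mdist_normB => h; exists g.
have xc : `|x| = c.
  apply/eqP; rewrite -subr_eq0 -normr_le0; apply/ler_addgt0Pl => e e0.
  have [g _ /ltW h] := near_orbit e e0; rewrite addr0 (le_trans _ h)//.
  by rewrite -[in leLHS]cu1 -(orthogonal_norm g (c *: _)) ler_dist_dist.
case: insubP => [w0 _ w0E|]; last first.
  rewrite xc; have [->|cn0] := eqVneq c 0; first by rewrite scale0r.
  rewrite mem_set // /sphere /= normrZ xc normfV ger0_norm// mulVf//.
pose w : sphere V := w0; have wE : set_val w = `|x|^-1 *: x by exact: w0E.
rewrite xc; have [->|cn0] := eqVneq c 0; first by rewrite !scale0r.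
have cgt0 : 0 < c by rewrite lt_def cn0.
congr (_ *: set_val (f _)); apply/mquot_piP/eqP.
change (orbit_dist (sphere_action V) G w u == 0).
rewrite eq_le orbit_dist_ge0 andbT; apply/ler_addgt0Pl => e e0.
have [g gG h] := near_orbit (c * e) (mulr_gt0 cgt0 e0).
apply: (le_trans (orbit_dist_le _ _ _ gG)); rewrite addr0.
have -> : mdist w (sphere_action V g u) =
    `|set_val w - orthogonal_fun g (set_val u)| by rewrite -mdist_normB.
rewrite -(ler_pM2l cgt0) -[X in X * _](ger0_norm c0) -normrZ scalerBr.
have -> : c *: set_val w = x.
  by rewrite wE xc scalerA mulfV ?scale1r.
by rewrite -orthogonal_funZ ltW.
Qed.

End HomogeneousExtension.

(* Main.v *)
Require Import Defs.
From HB Require Import structures.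
From mathcomp Require Import all_boot all_order all_algebra.
From mathcomp Require Import all_classical all_reals all_analysis.
From mathcomp Require Import ring.

(* For unit vectors, |a u - b v|^2 = (a - b)^2 + a b |u - v|^2. Taking infima
   over orbits, the distance between [a u] and [b v] in V//G satisfies the same
   identity with |u - v| replaced by the distance d between [u] and [v] in
   S(V)//G, while the distance between their images under f^* satisfies it with
   the distance d' between f [u] and f [v]. A dense orbit forces d = d' = 0,
   whence (a). In general, comparing the two identities termwise shows that a
   constant c is a lower (resp. upper) bound for f^* iff it is one for f and
   c <= 1 (resp. c >= 1): restricting to a = b = 1 recovers f, and to a = 1,
   b = 0 gives the comparison with 1. *)

Set Implicit Arguments.
Unset Strict Implicit.
Unset Printing Implicit Defensive.

Import Order.TTheory GRing.Theory Num.Theory.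
Import numFieldNormedType.Exports.

Local Open Scope classical_set_scope.
Local Open Scope ring_scope.

(** Both sides expand to [a^2 + b^2 - 2 a b <u, v>]. *)
Lemma norm_subZ_sqr (R : realType) (V : hilbertType R) (u v : V) (a b : R) :
  `|u| = 1 -> `|v| = 1 ->
  `|a *: u - b *: v| ^+ 2 = (a - b) ^+ 2 + a * b * `|u - v| ^+ 2.
Proof.
move=> u1 v1.
have uu : inner u u = 1 by rewrite -normr_inner u1 expr1n.
have vv : inner v v = 1 by rewrite -normr_inner v1 expr1n.
have uv : inner v u = inner u v by rewrite hermC expr0 mul1r.
rewrite !normr_inner !(linearBl inner) !(linearBr inner) !(linearZl_LR inner).
rewrite !(linearZr_LR inner) /= uu vv uv; ring.
Qed.

Section OrbitDist.
Context {R : realType} {gT : groupType} {X : metricType R}.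
Variables (to : isometric_action gT X) (G : groupClosed gT).

(** Since the action is by isometries, moving only the second point already approaches the infimum
    over both orbits. *)
Lemma le_orbit_dist (x y : X) (t : R) :
  (forall g, g \in G -> t <= mdist x (to g y)) -> t <= orbit_dist to G x y.
Proof.
move=> tle; apply/ler_addgt0Pr => e /(orbit_dist_lt to G x y)[g gG /ltW].
exact/le_trans/tle.
Qed.

(** Lets the infimum pass through squaring. A bound [s <= 0] is trivial; for positive [s], compare
    [Num.sqrt s] with the distances themselves. *)
Lemma le_orbit_dist_sqr (x y : X) (s : R) :
  (forall g, g \in G -> s <= mdist x (to g y) ^+ 2) ->
  s <= orbit_dist to G x y ^+ 2.
Proof.
move=> sle; have [s0|s0] := leP s 0; first exact: le_trans (sqr_ge0 _).
rewrite -[s]sqr_sqrtr ?(ltW s0)// ler_pXn2r ?nnegrE ?sqrtr_ge0 ?orbit_dist_ge0//.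
apply: le_orbit_dist => g gG.
by rewrite -[leRHS]ger0_norm ?mdist_ge0// -sqrtr_sqr ler_wsqrtr// sle.
Qed.

End OrbitDist.

(** For each [g] this is [norm_subZ_sqr] applied to [u] and [g v]. It survives the infimum because
    [t |-> (a - b)^2 + a b t^2] is continuous and nondecreasing on nonnegative [t]. *)
Lemma orbit_dist_scale_sqr (R : realType) (V : hilbertType R)
    (G : groupClosed (orthogonal_group V)) (u v : sphere V) (a b : R) :
  0 <= a -> 0 <= b ->
  orbit_dist (orthogonal_action V) G (a *: set_val u) (b *: set_val v) ^+ 2 =
  (a - b) ^+ 2 + a * b * orbit_dist (sphere_action V) G u v ^+ 2.
Proof.
move=> a0 b0; have ab0 := mulr_ge0 a0 b0.
have u1 : `|set_val u| = 1 := set_valP u.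
have v1 : `|set_val v| = 1 := set_valP v.
have distE g : mdist (a *: set_val u)
      (orthogonal_action V g (b *: set_val v)) ^+ 2 =
    (a - b) ^+ 2 + a * b * mdist u (sphere_action V g v) ^+ 2.
  have -> : mdist u (sphere_action V g v) =
    mdist (set_val u) (orthogonal_fun g (set_val v)) by [].
  rewrite /= orthogonal_funZ !mdist_normB norm_subZ_sqr//.
  by rewrite orthogonal_norm.
apply/eqP; rewrite eq_le; apply/andP; split; last first.
  apply: le_orbit_dist_sqr => g gG; rewrite distE lerD2l ler_wpM2l//.
  rewrite ler_pXn2r ?nnegrE ?mdist_ge0 ?orbit_dist_ge0//.
  exact: orbit_dist_le.
have dist_le g : g \in G ->
    orbit_dist (orthogonal_action V) G (a *: set_val u) (b *: set_val v) ^+ 2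
    <= (a - b) ^+ 2 + a * b * mdist u (sphere_action V g v) ^+ 2.
  move=> gG; rewrite -distE ler_pXn2r ?nnegrE ?mdist_ge0 ?orbit_dist_ge0//.
  exact: orbit_dist_le.
(* If [a * b = 0], the right side does not depend on [g] and the identity element suffices.
   Otherwise the inequality is solved for the squared distance on the sphere before taking the
   infimum. *)
have [ab|abN0] := eqVneq (a * b) 0.
  by have := dist_le 1%g gpred1; rewrite ab !mul0r.
have ab_gt0 : 0 < a * b by rewrite lt_def abN0.
rewrite -lerBlDl mulrC -ler_pdivrMr//; apply: le_orbit_dist_sqr => g gG.
by rewrite ler_pdivrMr// lerBlDl mulrC dist_le.
Qed.

(** Nontriviality supplies the unit vector that accompanies [c = 0] at the class of the origin. *)
Lemma mquot_pi_polar (R : realType) (V : hilbertType R)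
    (G : groupClosed (orthogonal_group V)) :
  (exists v : V, v != 0) ->
  forall A : metric_quotient (orthogonal_action V) G,
  exists c (u : sphere V),
    0 <= c /\ A = mquot_pi (orthogonal_action V) G (c *: set_val u).
Proof.
have normalize (x : V) : x != 0 -> exists u : sphere V, x = `|x| *: set_val u.
  move=> x0; have nx0 : `|x| != 0 by rewrite normr_eq0.
  have xS : sphere V (`|x|^-1 *: x).
    by rewrite /sphere /= normrZ normfV normr_id mulVf.
  by exists (SigSub (mem_set xS)); rewrite /= scalerA mulfV// scale1r.
move=> [v /normalize[w _]] A; have [x <-] := mquot_pi_surj A.
have [->|/normalize[u xE]] := eqVneq x 0.
  by exists 0, w; rewrite scale0r.
by exists `|x|, u; rewrite -xE.
Qed.

Section HomExt.
Context {R : realType} {V W : hilbertType R}.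
Context (G : groupClosed (orthogonal_group V)).
Local Notation piS := (mquot_pi (sphere_action V) G).
Local Notation piV := (mquot_pi (orthogonal_action V) G).
Variable f : metric_quotient (sphere_action V) G -> sphere W.

Lemma mdist_pi_scale_sqr (u v : sphere V) (a b : R) : 0 <= a -> 0 <= b ->
  mdist (piV (a *: set_val u)) (piV (b *: set_val v)) ^+ 2 =
  (a - b) ^+ 2 + a * b * mdist (piS u) (piS v) ^+ 2.
Proof.
move=> a0 b0; rewrite -[mdist (piV _) _]/(mquot_dist _ _).
by rewrite -[mdist (piS _) _]/(mquot_dist _ _) !mquot_dist_pi orbit_dist_scale_sqr.
Qed.

Lemma mdist_hom_ext_sqr (u v : sphere V) (a b : R) : 0 <= a -> 0 <= b ->
  mdist (hom_ext f (piV (a *: set_val u))) (hom_ext f (piV (b *: set_val v)))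
    ^+ 2 =
  (a - b) ^+ 2 + a * b * mdist (f (piS u)) (f (piS v)) ^+ 2.
Proof.
move=> a0 b0; rewrite !hom_extE// mdist_normB norm_subZ_sqr.
- have -> : mdist (f (piS u)) (f (piS v)) =
    mdist (set_val (f (piS u))) (set_val (f (piS v))) by [].
  by rewrite mdist_normB.
- exact: (set_valP (f (piS u))).
- exact: (set_valP (f (piS v))).
Qed.

Lemma mdist_pi_sphere (u v : sphere V) :
  mdist (piV (set_val u)) (piV (set_val v)) = mdist (piS u) (piS v).
Proof.
apply/eqP; rewrite -(@eqrXn2 _ 2) ?mdist_ge0//; apply/eqP.
have := mdist_pi_scale_sqr u v ler01 ler01.
by rewrite !scale1r subrr expr0n add0r !mul1r.
Qed.

Lemma mdist_hom_ext_sphere (u v : sphere V) :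
  mdist (hom_ext f (piV (set_val u))) (hom_ext f (piV (set_val v))) =
  mdist (f (piS u)) (f (piS v)).
Proof.
apply/eqP; rewrite -(@eqrXn2 _ 2) ?mdist_ge0//; apply/eqP.
have := mdist_hom_ext_sqr u v ler01 ler01.
by rewrite !scale1r subrr expr0n add0r !mul1r.
Qed.

Lemma mdist_pi_sphere0 (u : sphere V) :
  mdist (piV (set_val u)) (piV 0) = 1.
Proof.
apply/eqP; rewrite -(@eqrXn2 _ 2) ?mdist_ge0//; apply/eqP.
(* The second [u] gets the coefficient 0, so it only stands for the origin. *)
have := mdist_pi_scale_sqr u u ler01 (lexx 0).
by rewrite scale1r scale0r mulr0 mul0r addr0 subr0.
Qed.

Lemma mdist_hom_ext_sphere0 (u : sphere V) :
  mdist (hom_ext f (piV (set_val u))) (hom_ext f (piV 0)) = 1.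
Proof.
apply/eqP; rewrite -(@eqrXn2 _ 2) ?mdist_ge0//; apply/eqP.
have := mdist_hom_ext_sqr u u ler01 (lexx 0).
by rewrite scale1r scale0r mulr0 mul0r addr0 subr0.
Qed.

Hypothesis nontrivialV : exists v : V, v != 0.

Lemma sphere_inhabited : inhabited (sphere V).
Proof. by have [c [u _]] := mquot_pi_polar nontrivialV (piV 0). Qed.

Lemma lower_lipschitz_bound_hom_ext (a : \bar R) : (0 <= a)%E ->
  lower_lipschitz_bound (hom_ext f) a <->
  lower_lipschitz_bound f a /\ (a <= 1)%E.
Proof.
move=> a_ge0; split=> [lba|[lba a1]].
  split=> [A B|].
    have [u <-] := mquot_pi_surj A; have [v <-] := mquot_pi_surj B.
    by rewrite -mdist_pi_sphere -mdist_hom_ext_sphere.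
  have [u] := sphere_inhabited; have := lba (piV (set_val u)) (piV 0).
  by rewrite mdist_pi_sphere0 mdist_hom_ext_sphere0 mule1.
(* The bounds [0 <= a] and [a <= 1] exclude both infinities, leaving a real [m]. *)
case: a a_ge0 a1 lba => [m| |]//; rewrite !lee_fin => m0 m1 lbm.
move=> A B; have [a [u [a0 ->]]] := mquot_pi_polar nontrivialV A.
have [b [v [b0 ->]]] := mquot_pi_polar nontrivialV B.
have := lbm (piS u) (piS v); rewrite -!EFinM !lee_fin => mD.
rewrite -(@ler_pXn2r _ 2) ?nnegrE ?mulr_ge0 ?mdist_ge0// exprMn.
(* The radial term is compared using [m^2 <= 1], the spherical one using the bound for [f]. *)
rewrite mdist_pi_scale_sqr// mdist_hom_ext_sqr// mulrDr lerD//.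
  by rewrite ler_piMl ?sqr_ge0// expr_le1.
rewrite mulrCA ler_wpM2l ?mulr_ge0// -exprMn.
by rewrite ler_pXn2r ?nnegrE ?mulr_ge0 ?mdist_ge0.
Qed.

Lemma upper_lipschitz_bound_hom_ext (b : \bar R) : (0 <= b)%E ->
  upper_lipschitz_bound (hom_ext f) b <->
  upper_lipschitz_bound f b /\ (1 <= b)%E.
Proof.
move=> b_ge0; split=> [ubb|[ubb b1]].
  split=> [A B|].
    have [u <-] := mquot_pi_surj A; have [v <-] := mquot_pi_surj B.
    by rewrite -mdist_pi_sphere -mdist_hom_ext_sphere.
  have [u] := sphere_inhabited; have := ubb (piV (set_val u)) (piV 0).
  by rewrite mdist_pi_sphere0 mdist_hom_ext_sphere0 mule1.
move=> A B; case: b b_ge0 b1 ubb => [m| |]//; last first.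
  (* For the constant [+oo], the convention [+oo * 0 = 0] makes coinciding points a separate
     case. *)
  move=> _ _ _; have [->|AB] := eqVneq A B; first by rewrite !mdistxx mule0.
  rewrite gt0_mulye ?leey// lte_fin lt_def mdist_ge0 andbT.
  by apply: contra_neq AB; exact: mdist_positivity.
rewrite !lee_fin => m0 m1 ubm.
have [a [u [a0 ->]]] := mquot_pi_polar nontrivialV A.
have [b [v [b0 ->]]] := mquot_pi_polar nontrivialV B.
have := ubm (piS u) (piS v); rewrite -!EFinM !lee_fin => mD.
rewrite -(@ler_pXn2r _ 2) ?nnegrE ?mulr_ge0 ?mdist_ge0// exprMn.
rewrite mdist_pi_scale_sqr// mdist_hom_ext_sqr// mulrDr lerD//.
  by rewrite ler_peMl ?sqr_ge0// expr_ge1.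
rewrite [leRHS]mulrCA ler_wpM2l ?mulr_ge0// -exprMn.
by rewrite ler_pXn2r ?nnegrE ?mulr_ge0 ?mdist_ge0.
Qed.

End HomExt.

(** A dense orbit meets every ball, so every point is at orbit distance 0 from its base point [z];
    the triangle inequality through [z] does the rest. *)
Lemma topologically_transitive_orbit_dist (R : realType) (gT : groupType)
    (X : metricType R) (to : isometric_action gT X) (G : groupClosed gT) :
  topologically_transitive to G -> forall x y, orbit_dist to G x y = 0.
Proof.
move=> [z zdense].
have z0 x : orbit_dist to G x z = 0.
  apply/eqP; rewrite eq_le orbit_dist_ge0 andbT; apply/ler_addgt0Pr => e e0.
  have xe : (ball x e)° !=set0 by exists x; exact/nbhsx_ballx.
  have [_ [/[swap] [[g gG <-]] /interior_subset]] :=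
    zdense _ xe (@open_interior _ _).
  rewrite ballEmdist /= add0r => /ltW.
  exact/le_trans/orbit_dist_le.
move=> x y; apply/eqP; rewrite eq_le orbit_dist_ge0 andbT.
by rewrite (le_trans (orbit_dist_triangle to G z _ _))// z0 orbit_distC z0 addr0.
Qed.

Theorem theorem13 (R : realType) (V W : hilbertType R)
    (nontrivialV : exists v : V, v != 0) (nontrivialW : exists w : W, w != 0)
    (G : groupClosed (orthogonal_group V)) :
  (topologically_transitive (sphere_action V) G ->
   forall f : metric_quotient (sphere_action V) G -> sphere W,
     distance_preserving (hom_ext f)) /\
  (~ topologically_transitive (sphere_action V) G ->
   forall (f : metric_quotient (sphere_action V) G -> sphere W)
     (alpha beta : \bar R),
     optimal_bilipschitz_bounds f alpha beta ->
     optimal_bilipschitz_bounds (hom_ext f)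
       (Order.min alpha 1%E) (Order.max beta 1%E)).
Proof.
split=> [transG f A B|_ f alpha beta].
  have [a [u [a0 ->]]] := mquot_pi_polar nontrivialV A.
  have [b [v [b0 ->]]] := mquot_pi_polar nontrivialV B.
  apply/eqP; rewrite -(@eqrXn2 _ 2) ?mdist_ge0//; apply/eqP.
  rewrite mdist_hom_ext_sqr// mdist_pi_scale_sqr//.
  (* The spherical quotient is a single point, so both squared distances reduce to [(a - b)^2]. *)
  have -> : mquot_pi (sphere_action V) G u = mquot_pi (sphere_action V) G v.
    exact/mquot_piP/topologically_transitive_orbit_dist.
  by rewrite !mdistxx.
move=> [[a0 lba amax] [b0 ubb bmin]]; split; split.
- by rewrite le_min a0 lee01.
- apply/lower_lipschitz_bound_hom_ext => //; first by rewrite le_min a0 lee01.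
  split; last by rewrite ge_min lexx orbT.
  (* Decreasing a lower bound keeps it a lower bound, as distances are nonnegative. *)
  move=> A B; apply: le_trans (lba A B).
  by rewrite lee_wpmul2r ?lee_fin ?mdist_ge0// ge_min lexx.
- move=> a' a'0 /(lower_lipschitz_bound_hom_ext f nontrivialV a'0)[lba' a'1].
  by rewrite le_min a'1 amax.
- by rewrite le_max b0.
- apply/upper_lipschitz_bound_hom_ext => //; first by rewrite le_max b0.
  split; last by rewrite le_max lexx orbT.
  move=> A B; apply: (le_trans (ubb A B)).
  by rewrite lee_wpmul2r ?lee_fin ?mdist_ge0// le_max lexx.
- move=> b' b'0 /(upper_lipschitz_bound_hom_ext f nontrivialV b'0)[ubb' b'1].
  by rewrite ge_max b'1 bmin.
Qed.
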